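(* Let $R$ be a reduced ring and $n$ any positive integer. Then the following are equivalent. (1) $R$ is left pseudo-morphic. (2) $R$ is left quasi-morphic. (3) $R$ is left morphic. (4) $R[x]/\langle x^n\rangle$ is left pseudo-morphic. (5) $R[x]/\langle x^n\rangle$ is left quasi-morphic. (6) $R[x]/\langle x^n\rangle$ is left morphic. (7) $R$ is (von Neumann) regular. (8) $R$ is unit regular. (9) $R$ is strongly regular. Moreover, if in any of the conditions (1)–(6) ''left'' is changed into ''right'', or ''left'' is deleted (i.e. both-sided conditions are required), the resulting conditions are still equivalent to (1).
   Context: Rings are associative with identity; a ring is reduced if it has no nonzero nilpotent elements; $R[x]$ is the polynomial ring in a central indeterminate. For $a$ in a ring $S$, $l(a)=\{s\in S: sa=0\}$. $S$ is left pseudo-morphic if for every $a\in S$ there is $b\in S$ with $Sa=l(b)$; left quasi-morphic if for every $a\in S$ there are $b,c\in S$ with $Sa=l(b)$ and $l(a)=Sc$; left morphic if for every $a\in S$ there is $b\in S$ with $Sa=l(b)$ and $l(a)=Sb$. Right versions are symmetric; without a side, both left and right are required. $S$ is von Neumann regular if every $a\in S$ satisfies $a\in aSa$; unit regular if for every $a$ there is a unit $u$ with $a=aua$; strongly regular if every $a\in S$ satisfies $a\in Sa^2$. *)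

(* Defs.v *)
From HB Require Import structures.
From mathcomp Require Import all_boot all_algebra.
From mathcomp Require Import boolp classical_sets.
Set Implicit Arguments.
Unset Strict Implicit.
Unset Printing Implicit Defensive.
Import GRing.Theory.
Local Open Scope classical_set_scope.
Local Open Scope ring_scope.

Section RingConditions.
Variable S : pzRingType.
Implicit Types a b c s u v : S.

Definition left_ann a : set S := [set s | s * a = 0].
Definition right_ann a : set S := [set s | a * s = 0].
Definition left_principal a : set S := [set s * a | s in setT].
Definition right_principal a : set S := [set a * s | s in setT].

Definition nilpotent a : Prop := exists k : nat, (0 < k)%N /\ a ^+ k = 0.
Definition reduced_ring : Prop := forall a, nilpotent a -> a = 0.

Definition left_pseudo_morphic : Prop :=
  forall a, exists b, left_principal a = left_ann b.
Definition left_quasi_morphic : Prop :=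
  forall a, exists b c,
    left_principal a = left_ann b /\ left_ann a = left_principal c.
Definition left_morphic : Prop :=
  forall a, exists b,
    left_principal a = left_ann b /\ left_ann a = left_principal b.

Definition right_pseudo_morphic : Prop :=
  forall a, exists b, right_principal a = right_ann b.
Definition right_quasi_morphic : Prop :=
  forall a, exists b c,
    right_principal a = right_ann b /\ right_ann a = right_principal c.
Definition right_morphic : Prop :=
  forall a, exists b,
    right_principal a = right_ann b /\ right_ann a = right_principal b.

Definition pseudo_morphic : Prop :=
  left_pseudo_morphic /\ right_pseudo_morphic.
Definition quasi_morphic : Prop := left_quasi_morphic /\ right_quasi_morphic.
Definition morphic : Prop := left_morphic /\ right_morphic.

Definition regular_ring : Prop := forall a, exists s, a = a * s * a.
(* [GRing.unit] requires a decidable notion of unit, which an arbitrary ring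
   does not carry; a unit is an element with a two-sided inverse. *)
Definition is_unit u : Prop := exists v, u * v = 1 /\ v * u = 1.
Definition unit_regular_ring : Prop :=
  forall a, exists u, is_unit u /\ a = a * u * a.
Definition strongly_regular_ring : Prop :=
  forall a, exists s, a = s * a ^+ 2.

End RingConditions.

Arguments reduced_ring : clear implicits.
Arguments left_pseudo_morphic : clear implicits.
Arguments left_quasi_morphic : clear implicits.
Arguments left_morphic : clear implicits.
Arguments right_pseudo_morphic : clear implicits.
Arguments right_quasi_morphic : clear implicits.
Arguments right_morphic : clear implicits.
Arguments pseudo_morphic : clear implicits.
Arguments quasi_morphic : clear implicits.
Arguments morphic : clear implicits.
Arguments regular_ring : clear implicits.
Arguments unit_regular_ring : clear implicits.
Arguments strongly_regular_ring : clear implicits.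

(* The library only provides quotient rings of commutative rings; here the
   ring P may be noncommutative and <a> is the two-sided ideal P a P. *)
Section QuotientByGenerated.
Variables (P : pzRingType) (a : P).

Definition gen_ideal : {pred P} :=
  fun p => `[< exists s : seq (P * P), p = \sum_(u <- s) u.1 * a * u.2 >].

Lemma gen_idealP p :
  reflect (exists s : seq (P * P), p = \sum_(u <- s) u.1 * a * u.2)
          (p \in gen_ideal).
Proof. exact: asboolP. Qed.

Lemma gen_ideal_zmod_closed : zmod_closed gen_ideal.
Proof.
split=> [|p q /gen_idealP[s ->] /gen_idealP[t ->]]; apply/gen_idealP.
  by exists [::]; rewrite big_nil.
exists (s ++ [seq (- u.1, u.2) | u <- t]).
rewrite big_cat big_map /= -sumrN; congr (_ + _).
by apply: eq_bigr => u _; rewrite !mulNr.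
Qed.

HB.instance Definition _ := GRing.isZmodClosed.Build P gen_ideal
  gen_ideal_zmod_closed.

Lemma gen_idealMl p q : q \in gen_ideal -> p * q \in gen_ideal.
Proof.
move=> /gen_idealP[s ->]; apply/gen_idealP.
exists [seq (p * u.1, u.2) | u <- s]; rewrite big_map mulr_sumr.
by apply: eq_bigr => u _; rewrite /= !mulrA.
Qed.

Lemma gen_idealMr p q : q \in gen_ideal -> q * p \in gen_ideal.
Proof.
move=> /gen_idealP[s ->]; apply/gen_idealP.
exists [seq (u.1, u.2 * p) | u <- s]; rewrite big_map mulr_suml.
by apply: eq_bigr => u _; rewrite /= !mulrA.
Qed.

Definition quot_gen := Quotient.quot gen_ideal.
HB.instance Definition _ := GRing.Zmodule.on quot_gen.

Definition quot_pi (p : P) : quot_gen := (\pi_(Quotient.quot gen_ideal) p)%qT.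
Definition quot_one : quot_gen := quot_pi 1.
Definition quot_mul (x y : quot_gen) : quot_gen :=
  quot_pi (repr (x : Quotient.quot gen_ideal)
           * repr (y : Quotient.quot gen_ideal)).

Lemma quot_pi_eq p q : quot_pi p = quot_pi q <-> p - q \in gen_ideal.
Proof. by split=> [/eqP|h]; [|apply/eqP]; rewrite -Quotient.idealrBE. Qed.

Lemma quot_pi_surj (x : quot_gen) : exists p, quot_pi p = x.
Proof. by exists (repr (x : Quotient.quot gen_ideal)); apply: reprK. Qed.

Lemma quot_piM p q : quot_pi (p * q) = quot_mul (quot_pi p) (quot_pi q).
Proof.
rewrite /quot_mul.
set p' := repr (quot_pi p : Quotient.quot gen_ideal).
set q' := repr (quot_pi q : Quotient.quot gen_ideal).
have hp : p - p' \in gen_ideal by apply/quot_pi_eq/esym; apply: reprK.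
have hq : q - q' \in gen_ideal by apply/quot_pi_eq/esym; apply: reprK.
apply/quot_pi_eq.
have -> : p * q - p' * q' = (p - p') * q + p' * (q - q').
  by rewrite mulrBl mulrBr addrA subrK.
by apply: rpredD; [apply: gen_idealMr | apply: gen_idealMl].
Qed.

Lemma quot_piB p q : quot_pi (p - q) = quot_pi p - quot_pi q.
Proof. exact: raddfB. Qed.

Lemma quot_piD p q : quot_pi (p + q) = quot_pi p + quot_pi q.
Proof. exact: raddfD. Qed.

Lemma quot_mulA : associative quot_mul.
Proof.
move=> x y z; have [p <-] := quot_pi_surj x.
have [q <-] := quot_pi_surj y; have [r <-] := quot_pi_surj z.
by rewrite -!quot_piM mulrA.
Qed.

Lemma quot_mul1r : left_id quot_one quot_mul.
Proof.
by move=> x; have [p <-] := quot_pi_surj x; rewrite -quot_piM mul1r.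
Qed.

Lemma quot_mulr1 : right_id quot_one quot_mul.
Proof.
by move=> x; have [p <-] := quot_pi_surj x; rewrite -quot_piM mulr1.
Qed.

Lemma quot_mulDl : left_distributive quot_mul +%R.
Proof.
move=> x y z; have [p <-] := quot_pi_surj x.
have [q <-] := quot_pi_surj y; have [r <-] := quot_pi_surj z.
by rewrite -quot_piD -!quot_piM -quot_piD mulrDl.
Qed.

Lemma quot_mulDr : right_distributive quot_mul +%R.
Proof.
move=> x y z; have [p <-] := quot_pi_surj x.
have [q <-] := quot_pi_surj y; have [r <-] := quot_pi_surj z.
by rewrite -quot_piD -!quot_piM -quot_piD mulrDr.
Qed.

HB.instance Definition _ := GRing.Zmodule_isPzRing.Build quot_gen
  quot_mulA quot_mul1r quot_mulr1 quot_mulDl quot_mulDr.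

HB.instance Definition _ := GRing.isZmodMorphism.Build P quot_gen quot_pi
  quot_piB.
HB.instance Definition _ := GRing.isMonoidMorphism.Build P quot_gen quot_pi
  (erefl, quot_piM).

End QuotientByGenerated.

Section TruncatedPolynomials.
Variable R : pzRingType.

Definition nz_ring (R1 : 1 <> 0 :> R) : nzRingType :=
  HB.pack R (GRing.PzSemiRing_isNonZero.Build R (introN eqP R1)).

(* R[x]/<x^n>.  Rings may be zero, whereas [{poly R}] requires 1 != 0; if 1 = 0
   in R, then R[x]/<x^n> is the zero ring, that is, R itself. *)
Definition trunc_poly (n : nat) : pzRingType :=
  match pselect (1 = 0 :> R) with
  | left _ => R
  | right R1 => quot_gen ('X^n : {poly nz_ring R1})
  end.

End TruncatedPolynomials.

(* Main.v *)
Require Import Defs.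
From mathcomp Require Import all_boot all_algebra.
From mathcomp Require Import boolp classical_sets.
Set Implicit Arguments.
Unset Strict Implicit.
Unset Printing Implicit Defensive.
Import GRing.Theory.
Local Open Scope ring_scope.

(** In a reduced ring [xy = 0] iff [yx = 0], and idempotents are central.

    If [R] is regular, every [a = asa] has a central idempotent [e = as = sa],
    and [a + (1 - e)] is a unit.  Peeling off the idempotents of the successive
    coefficients of [f] in [T = R[x]/<x^n>] writes [f = w g] with [w] a unit and
    [g = \sum_k e_k x^k], the [e_k] being orthogonal central idempotents of
    sum 1 (k <= n).  The central elements [g] and [b = \sum_k e_k x^(n-k)]
    are annihilators of each other, so [T] is left and right morphic.

    Conversely, if [T (a^2 x^(n-1)) = l(b)], the constant term [b_0] satisfies
    [a^2 b_0 = 0], hence [a b_0 = 0] because [R] is reduced, hence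
    [a x^(n-1) \in l(b)], and comparing coefficients gives [a \in R a^2].

    The ring [R] itself is the case [n = 1]. *)

(** * Reduced rings: zero products, idempotents and regularity *)

Section ReducedRings.
Variable R : pzRingType.
Hypothesis R_reduced : reduced_ring R.
Implicit Types a b e r s : R.

Lemma reduced_mulr_eq0C a b : a * b = 0 -> b * a = 0.
Proof.
move=> ab0; apply: R_reduced; exists 2%N; split=> //.
by rewrite expr2 mulrA -(mulrA b) ab0 mulr0 mul0r.
Qed.

(** Reversing [a * (a * b) = 0] gives [a * b * a = 0], so [a * b] squares to zero. *)
Lemma reduced_sqr_mul_eq0 a b : a ^+ 2 * b = 0 -> a * b = 0.
Proof.
rewrite expr2 -mulrA => /reduced_mulr_eq0C aba0.
by apply: R_reduced; exists 2%N; rewrite expr2 mulrA aba0 mul0r.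
Qed.

Lemma reduced_mul_sqr_eq0 a b : b * a ^+ 2 = 0 -> b * a = 0.
Proof.
by move=> /reduced_mulr_eq0C /reduced_sqr_mul_eq0 /reduced_mulr_eq0C.
Qed.

(** Both [e * r * (1 - e)] and [(1 - e) * r * e] vanish, because reversing the product puts [e] next
    to [1 - e]. *)
Lemma reduced_idem_central e : e * e = e -> forall r, GRing.comm e r.
Proof.
move=> ee r.
have e1 : e * (1 - e) = 0 by rewrite mulrBr mulr1 ee subrr.
have e2 : (1 - e) * e = 0 by rewrite mulrBl mul1r ee subrr.
have /eqP : e * (r * (1 - e)) = 0.
  by apply: reduced_mulr_eq0C; rewrite -mulrA e2 mulr0.
have /eqP : (1 - e) * r * e = 0.
  by apply: reduced_mulr_eq0C; rewrite mulrA e1 mul0r.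
rewrite mulrBr mulr1 !mulrBl mul1r mulrBr mulrA !subr_eq0.
by move=> /eqP re /eqP er; rewrite /GRing.comm er re.
Qed.

Lemma reduced_regular_inverse : regular_ring R -> forall a, exists s,
  [/\ a * s * a = a, s * a = a * s & forall r, GRing.comm (a * s) r].
Proof.
move=> reg a; have [s as_a] := reg a; exists s.
have asC r : GRing.comm (a * s) r.
  by apply: reduced_idem_central; rewrite mulrA -as_a.
have saC r : GRing.comm (s * a) r.
  by apply: reduced_idem_central; rewrite !mulrA -(mulrA s a s) -mulrA -as_a.
split=> //.
(* The product of these two idempotents equals each of them, as either one commutes with the
   adjacent [a]. *)
have h1 : (s * a) * (a * s) = a * s.
  by rewrite mulrA (saC a) mulrA -as_a.
by rewrite -h1 -mulrA -asC -as_a.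
Qed.

(** From [a = r * a ^+ 2] follows [(1 - r * a) * a = 0], and reversal gives [a = a * r * a]; the
    other case is symmetric. *)
Lemma reduced_sqr_regular :
  (forall a, exists r, a = r * a ^+ 2) \/
  (forall a, exists r, a = a ^+ 2 * r) ->
  regular_ring R.
Proof.
case=> sreg a; have [r ar] := sreg a; exists r; apply/eqP.
  rewrite -subr_eq0 -[X in X - _]mulr1 -mulrA -mulrBr.
  apply/eqP/reduced_mulr_eq0C.
  by rewrite mulrBl mul1r -mulrA -expr2 -ar subrr.
rewrite -subr_eq0 -[X in X - _]mul1r -mulrBl.
apply/eqP/reduced_mulr_eq0C.
by rewrite mulrBr mulr1 mulrA -expr2 -ar subrr.
Qed.

Lemma reduced_strongly_regularE : strongly_regular_ring R <-> regular_ring R.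
Proof.
split=> [sreg|reg a]; first by apply: reduced_sqr_regular; left.
have [s [asa sa _]] := reduced_regular_inverse reg a.
by exists s; rewrite expr2 mulrA sa asa.
Qed.

End ReducedRings.

(** * Units, Peirce decomposition and mutually annihilating central elements *)

Section Idempotents.
Variable T : pzRingType.
Implicit Types a b e f g r s t u v w x y : T.

Lemma is_unitM u v : is_unit u -> is_unit v -> is_unit (u * v).
Proof.
move=> [u' [uu' u'u]] [v' [vv' v'v]]; exists (v' * u').
by rewrite !mulrA -(mulrA u) vv' mulr1 -(mulrA v') u'u mulr1.
Qed.

Lemma is_unit1B_nilpotent y n : y ^+ n = 0 -> is_unit (1 - y).
Proof.
move=> yn0; exists (\sum_(i < n) y ^+ i).
have h : (1 - y) * (\sum_(i < n) y ^+ i) = 1.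
  by rewrite -opprB mulNr -subrX1 yn0 sub0r opprK.
split=> //; rewrite -[RHS]h; apply/esym/commr_sum => i _.
by apply/commrX/commr_sym/commrB; [apply: commr1 | apply: commr_refl].
Qed.

(** With [e = a * s], this is [a], which has inverse [e * s] in the corner eT, plus the identity of
    the complementary corner. *)
Lemma is_unit_add_compl a s : a * s * a = a -> s * a = a * s ->
  (forall r, GRing.comm (a * s) r) -> is_unit (a + (1 - a * s)).
Proof.
have [e ase] : exists e, a * s = e by exists (a * s).
rewrite ase => ea sa eC.
have ee : e * e = e by rewrite -[X in e * X]ase mulrA ea.
have ae : a * e = a by rewrite -eC.
have e0 : e * (1 - e) = 0 by rewrite mulrBr mulr1 ee subrr.
have e0' : (1 - e) * e = 0 by rewrite mulrBl mul1r ee subrr.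
have f2 : (1 - e) * (1 - e) = 1 - e by rewrite mulrBr e0' subr0 mulr1.
have a0 : a * (1 - e) = 0 by rewrite mulrBr mulr1 ae subrr.
have a0' : (1 - e) * a = 0 by rewrite mulrBl mul1r ea subrr.
have ef1 : e + (1 - e) = 1 by rewrite subrKC.
move: (1 - e) e0 e0' f2 a0 a0' ef1 => f ef fe ff af fa ef1.
exists (e * s + f); split.
  by rewrite mulrDl !mulrDr ff af !mulrA fe ae ase mul0r addr0 add0r.
rewrite mulrDl !mulrDr ff fa -[e * s * a]mulrA sa ee.
by rewrite eC -mulrA ef mulr0 addr0 add0r.
Qed.

Section Peirce.
Variable e : T.
Hypotheses (ee : e * e = e) (eC : forall r, GRing.comm e r).

(** The pair (ea, (1-e)b) in T = eT x (1-e)T, for a central idempotent [e]. *)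
Definition peirce a b : T := e * a + (1 - e) * b.

Lemma idem_compl : (1 - e) * (1 - e) = 1 - e.
Proof. by rewrite mulrBr mulr1 !mulrBl !mul1r ee subrr subr0. Qed.

Lemma compl_central r : GRing.comm (1 - e) r.
Proof. by rewrite /GRing.comm mulrBl mulrBr mul1r mulr1 eC. Qed.

Lemma peirceM a b c d : peirce a b * peirce c d = peirce (a * c) (b * d).
Proof.
have e0 : e * (1 - e) = 0 by rewrite mulrBr mulr1 ee subrr.
have e0' : (1 - e) * e = 0 by rewrite mulrBl mul1r ee subrr.
have swap p g r t : (forall q, GRing.comm g q) ->
    p * r * (g * t) = p * g * (r * t).
  by move=> gC; rewrite !mulrA -!(mulrA p) -gC.
rewrite /peirce mulrDl !mulrDr !(swap _ _ _ _ eC) !(swap _ _ _ _ compl_central).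
by rewrite ee e0 e0' idem_compl !mul0r addr0 add0r.
Qed.

Lemma peirce_diag a : peirce a a = a.
Proof. by rewrite /peirce -mulrDl subrKC mul1r. Qed.

Lemma peirce_central a b : (forall r, GRing.comm a r) ->
  (forall r, GRing.comm b r) -> forall r, GRing.comm (peirce a b) r.
Proof.
move=> aC bC r; rewrite /GRing.comm -(peirce_diag r) !peirceM.
by rewrite (aC r) (bC r).
Qed.

Lemma is_unit_peirce u v : is_unit u -> is_unit v -> is_unit (peirce u v).
Proof.
move=> [u' [uu' u'u]] [v' [vv' v'v]]; exists (peirce u' v').
by rewrite !peirceM uu' u'u vv' v'v peirce_diag.
Qed.

Lemma peirce_eq0 a b : peirce a b = 0 -> e * a = 0 /\ (1 - e) * b = 0.
Proof.
move=> ab0; split.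
  have := peirceM 1 0 a b; rewrite ab0 mulr0 mul1r mul0r.
  by rewrite /peirce !mulr0 addr0.
have := peirceM 0 1 a b; rewrite ab0 mulr0 mul1r mul0r.
by rewrite /peirce !mulr0 add0r.
Qed.

End Peirce.

Definition ann_gen b g := forall s, s * b = 0 <-> exists t, s = t * g.

(** For central elements left and right annihilators agree, so these conditions serve both sides. *)
Definition complementary g b :=
  [/\ forall r, GRing.comm g r, forall r, GRing.comm b r,
      ann_gen b g & ann_gen g b].

Lemma ann_gen_peirce e b1 b2 g1 g2 : e * e = e ->
  (forall r, GRing.comm e r) -> ann_gen b1 g1 -> ann_gen b2 g2 ->
  ann_gen (peirce e b1 b2) (peirce e g1 g2).
Proof.
move=> ee eC bg1 bg2 s; split=> [|[t ->]]; last first.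
  rewrite -{1}(peirce_diag e t) !peirceM //.
  have -> : t * g1 * b1 = 0 by apply/bg1; exists t.
  have -> : t * g2 * b2 = 0 by apply/bg2; exists t.
  exact: peirce_diag.
rewrite -{1}(peirce_diag e s) peirceM // => /(peirce_eq0 ee eC).
rewrite !mulrA => -[/bg1[t1 st1] /bg2[t2 st2]].
exists (peirce e t1 t2); rewrite peirceM // -st1 -st2.
by rewrite /peirce !mulrA ee (idem_compl ee) -mulrDl subrKC mul1r.
Qed.

Lemma complementary_peirce e g1 g2 b1 b2 : e * e = e ->
  (forall r, GRing.comm e r) -> complementary g1 b1 -> complementary g2 b2 ->
  complementary (peirce e g1 g2) (peirce e b1 b2).
Proof.
move=> ee eC [g1C b1C gb1 bg1] [g2C b2C gb2 bg2].
by split; [exact: peirce_central..| |]; exact: ann_gen_peirce.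
Qed.

Lemma complementary01 : complementary 0 1.
Proof.
split=> [r|r|s|s].
- exact/commr_sym/commr0.
- exact/commr_sym/commr1.
- rewrite mulr1; split=> [->|[t ->]]; last by rewrite mulr0.
  by exists 0; rewrite mulr0.
- by rewrite mulr0; split=> // _; exists s; rewrite mulr1.
Qed.

(** T w g = T g and l(w g) = l(g w) = l(g), since [w] is a unit and [g] is central. *)
Lemma complementary_left_morphic w g b : is_unit w -> complementary g b ->
  left_principal (w * g) = left_ann b /\ left_ann (w * g) = left_principal b.
Proof.
move=> [v [wv vw]] [gC bC gb bg]; split; apply/seteqP; split=> s /=.
- by move=> [t _ <-]; apply/gb; exists (t * w); rewrite mulrA.
- move=> /gb[t ->]; exists (t * v) => //.
  by rewrite mulrA -(mulrA t) vw mulr1.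
- rewrite /left_ann /= -gC mulrA => swg0.
  have /bg[t ->] : s * g = 0 by rewrite -[LHS]mulr1 -wv mulrA swg0 mul0r.
  by exists t.
- move=> [t _ <-]; rewrite /left_ann /= mulrA -(mulrA t) bC mulrA.
  by apply/bg; exists (t * w).
Qed.

Lemma complementary_right_morphic w g b : is_unit w -> complementary g b ->
  right_principal (w * g) = right_ann b /\
  right_ann (w * g) = right_principal b.
Proof.
move=> [v [wv vw]] [gC bC gb bg]; split; apply/seteqP; split=> s /=.
- move=> [t _ <-]; rewrite /right_ann /= bC; apply/gb.
  by exists (w * t); rewrite -!mulrA gC.
- rewrite /right_ann /= bC => /gb[t ->]; exists (v * t) => //.
  by rewrite -gC -!mulrA (mulrA w) wv mul1r gC.
- rewrite /right_ann /= => wgs0.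
  have /bg[t ->] : s * g = 0.
    by rewrite -gC -[LHS]mul1r -vw -mulrA (mulrA w) wgs0 mulr0.
  by exists t; rewrite // bC.
- move=> [t _ <-]; rewrite /right_ann /= -gC -mulrA gC; apply/bg.
  by exists (w * t); rewrite bC mulrA.
Qed.

End Idempotents.

(* What is needed of [T = R[x]/<x^n>], with [i : R -> T] the constants.  The map
   [i] is not packaged as a morphism because [nz_ring R1] and [R] carry the
   same operations but are not convertible as ring structures. *)
Record truncation (R T : pzRingType) (n : nat) (i : R -> T) (x : T) : Prop :=
  Truncation {
    truncB : forall a b, i (a - b) = i a - i b;
    truncM : forall a b, i (a * b) = i a * i b;
    trunc_central : forall t, GRing.comm x t;
    trunc_nilp : x ^+ n = 0;
    trunc_div : forall t, exists r t', t = i r + x * t';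
    trunc_ann : forall k t, (k <= n)%N -> x ^+ k * t = 0 ->
      exists t', t = x ^+ (n - k) * t';
    trunc_faithful : forall r, x ^+ n.-1 * i r = 0 -> r = 0
  }.

(** * Regular [R] gives a morphic truncation *)

Section Truncation.
Variables (R T : pzRingType) (n : nat) (i : R -> T) (x : T).
Hypotheses (R_reduced : reduced_ring R) (RT : truncation n i x).

Lemma trunc_expC k t : GRing.comm (x ^+ k) t.
Proof. exact/commr_sym/commrX/commr_sym/(trunc_central RT). Qed.

(** Peeling off constant terms puts the commutator of [i e] and [t] in x^k T for every k; at k = n
    it vanishes. *)
Lemma trunc_const_central e : (forall r, GRing.comm e r) ->
  forall t, GRing.comm (i e) t.
Proof.
move=> eC t; suff [t' h] : exists t', i e * t - t * i e = x ^+ n * t'.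
  by apply/eqP; rewrite -subr_eq0 h (trunc_nilp RT) mul0r.
elim: n t => [|k IHk] t; first by exists (i e * t - t * i e); rewrite mul1r.
have [r [t1 ->]] := trunc_div RT t; have [t' h] := IHk t1; exists t'.
rewrite mulrDr mulrDl -!(truncM RT) eC opprD addrACA subrr add0r.
by rewrite exprS -[RHS]mulrA -h mulrBr !mulrA (trunc_central RT (i e)).
Qed.

Lemma complementary_trunc_exp k : (k <= n)%N ->
  complementary (x ^+ k) (x ^+ (n - k)).
Proof.
have ann j : (j <= n)%N -> ann_gen (x ^+ (n - j)) (x ^+ j).
  move=> jn s; split=> [|[t ->]].
    rewrite -trunc_expC => /(trunc_ann RT (leq_subr _ _))[t ->].
    by exists t; rewrite subKn // trunc_expC.
  by rewrite -mulrA -exprD subnKC // (trunc_nilp RT) mulr0.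
move=> kn; split; [exact: trunc_expC.. | exact: ann |].
by rewrite -{1}(subKn kn); apply/ann/leq_subr.
Qed.

(** This is [u] times 1 minus a multiple of the central nilpotent [x]. *)
Lemma is_unit_trunc u y : is_unit u -> is_unit (u + x * y).
Proof.
move=> u_unit; have [v [uv _]] := u_unit.
have -> : u + x * y = u * (1 - x * (- (v * y))).
  rewrite mulrN opprK mulrDr mulr1 (trunc_central RT y).
  by rewrite (trunc_central RT (v * y)) !mulrA uv mul1r.
apply: is_unitM => //; apply: (@is_unit1B_nilpotent _ _ n).
by rewrite exprMn_comm ?(trunc_nilp RT) ?mul0r//; exact: (trunc_central RT).
Qed.

Hypothesis R_regular : regular_ring R.

(** Induction on m = n - k, with [r] the constant term of [h]. On the component of [e = i (r * s)],
    [x ^+ k] splits off with a unit cofactor; on the other component [r] vanishes, which leaves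
    [x ^+ k.+1 * h1] to the induction hypothesis. *)
Lemma trunc_central_factorization m k h : (k + m = n)%N ->
  exists w g b, [/\ is_unit w, x ^+ k * h = w * g & complementary g b].
Proof.
elim: m k h => [|m IHm] k h kmn.
  exists 1, 0, 1; split; [|..|exact: complementary01].
    by exists 1; rewrite mulr1.
  by rewrite -(addn0 k) kmn (trunc_nilp RT) mul0r mulr0.
have [r [h1 ->]] := trunc_div RT h.
have [s [rsr sr rsC]] := reduced_regular_inverse R_reduced R_regular r.
have [w2 [g2 [b2 [w2_unit xh1 gb2]]]] := IHm k.+1 h1 (etrans (addSnnS k m) kmn).
set e := i (r * s).
have eC : forall t, GRing.comm e t by apply: trunc_const_central.
have ee : e * e = e by rewrite -(truncM RT) mulrA rsr.
have er : e * i r = i r by rewrite -(truncM RT) rsr.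
have u_unit : is_unit (i r + (1 - e)).
  rewrite /e (truncM RT); apply: is_unit_add_compl.
  - by rewrite -!(truncM RT) rsr.
  - by rewrite -!(truncM RT) sr.
  - by rewrite -(truncM RT).
exists (peirce e (i r + (1 - e) + x * h1) w2).
exists (peirce e (x ^+ k) g2), (peirce e (x ^+ (n - k)) b2).
have kn : (k <= n)%N by rewrite -kmn leq_addr.
split; first exact/is_unit_peirce/w2_unit/is_unit_trunc.
  rewrite peirceM // -xh1 -{1}(peirce_diag e (i r + x * h1)).
  rewrite -{1}(peirce_diag e (x ^+ k)) peirceM // /peirce.
  congr (_ + _).
    (* The summand [1 - e], which made the cofactor a unit, is killed by [e]. *)
    rewrite trunc_expC !mulrA; congr (_ * _).
    by rewrite !mulrDr er mulr1 mulrN ee subrr addr0.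
  (* Here [1 - e] kills the constant term. *)
  rewrite exprSr !mulrDr addrC -[RHS]addr0 !mulrA; congr (_ + _).
  by rewrite -mulrA (trunc_expC k) mulrA mulrBl mul1r er subrr mul0r.
exact/complementary_peirce/gb2/complementary_trunc_exp.
Qed.

Lemma trunc_morphic : morphic T.
Proof.
suff fact (f : T) : exists w g b, [/\ is_unit w, f = w * g & complementary g b].
  by split=> f; have [w [g [b [w_unit -> gb]]]] := fact f; exists b;
     [apply: complementary_left_morphic | apply: complementary_right_morphic].
by rewrite -[f]mul1r -(expr0 x); apply: (@trunc_central_factorization n).
Qed.

End Truncation.

(** * A pseudo-morphic truncation forces [R] to be regular *)

Section TruncationConverse.
Variables (R T : pzRingType) (n : nat) (i : R -> T) (x : T).
Hypotheses (n_gt0 : (0 < n)%N) (R_reduced : reduced_ring R).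
Hypothesis RT : truncation n i x.

(** As n > 0, [xp] kills xT, and it is injective on constants: equal multiples of [xp] have
    cofactors with equal constant terms. *)
Let xp := x ^+ n.-1.

Let xpx t : xp * (x * t) = 0.
Proof. by rewrite mulrA -exprSr prednK // (trunc_nilp RT) mul0r. Qed.

Let xpC t : xp * t = t * xp. Proof. exact: trunc_expC RT _ _. Qed.

Let xp_inj a b : xp * i a = xp * i b -> a = b.
Proof.
move=> /eqP; rewrite -subr_eq0 -mulrBr -(truncB RT) => /eqP.
by move=> /(trunc_faithful RT) /eqP; rewrite subr_eq0 => /eqP.
Qed.

Let i0 : i 0 = 0. Proof. by rewrite -(subrr 0) (truncB RT) subrr. Qed.

Lemma trunc_left_pseudo_morphic_regular :
  left_pseudo_morphic T -> regular_ring R.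
Proof.
move=> lpm; apply: reduced_sqr_regular => //; left=> a.
have [b Eb] := lpm (xp * i (a ^+ 2)).
have [b0 [b1 b_def]] := trunc_div RT b.
have xpb c : xp * i c * b = xp * i (c * b0).
  rewrite b_def mulrDr -!mulrA (truncM RT) -[RHS]addr0; congr (_ + _).
  by rewrite (mulrA (i c)) -(trunc_central RT) -mulrA xpx.
have ab0 : a * b0 = 0.
  apply: reduced_sqr_mul_eq0 => //; apply: xp_inj; rewrite i0 mulr0 -xpb.
  (* The generator lies in its own left ideal, so [b] annihilates it. *)
  have : left_principal (xp * i (a ^+ 2)) (xp * i (a ^+ 2)).
    by exists 1; rewrite ?mul1r.
  by rewrite Eb.
have : left_ann b (xp * i a) by rewrite /left_ann /= xpb ab0 i0 mulr0.
rewrite -Eb => -[t _]; have [r [t1 ->]] := trunc_div RT t.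
rewrite mulrA -xpC mulrDr xpx addr0 -mulrA -(truncM RT) => /xp_inj/esym.
by exists r.
Qed.

(** With [b] acting from the left, the same comparison gives [b0 * a ^+ 2 = 0] and finally
    [a = a ^+ 2 * r]. *)
Lemma trunc_right_pseudo_morphic_regular :
  right_pseudo_morphic T -> regular_ring R.
Proof.
move=> rpm; apply: reduced_sqr_regular => //; right=> a.
have [b Eb] := rpm (xp * i (a ^+ 2)).
have [b0 [b1 b_def]] := trunc_div RT b.
have xpb c : b * (xp * i c) = xp * i (b0 * c).
  by rewrite mulrA -xpC b_def mulrDr xpx addr0 -mulrA (truncM RT).
have ab0 : b0 * a = 0.
  apply: reduced_mul_sqr_eq0 => //; apply: xp_inj; rewrite i0 mulr0 -xpb.
  have : right_principal (xp * i (a ^+ 2)) (xp * i (a ^+ 2)).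
    by exists 1; rewrite ?mulr1.
  by rewrite Eb.
have : right_ann b (xp * i a) by rewrite /right_ann /= xpb ab0 i0 mulr0.
rewrite -Eb => -[t _]; have [r [t1 ->]] := trunc_div RT t.
rewrite mulrDr -mulrA -(truncM RT) -mulrA (mulrA (i _)) -(trunc_central RT).
by rewrite -mulrA xpx addr0 => /xp_inj/esym; exists r.
Qed.

End TruncationConverse.

(** * Instances: [R] itself and the truncated polynomial rings *)

Lemma truncation_self (R : pzRingType) : truncation 1 (id : R -> R) 0.
Proof.
split=> //.
- by move=> t; apply/commr_sym/commr0.
- by move=> t; exists t, 0; rewrite mulr0 addr0.
(* For k = 1 the witness is [t] itself, as [0 ^+ 0 = 1]; for k = 0 the hypothesis already says t =
   0. *)
- case=> [|[|//]] t _; last by exists t; rewrite mul1r.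
  by rewrite mul1r => ->; exists 0; rewrite mulr0.
- by move=> r; rewrite mul1r.
Qed.

(** Centrality of ['X^n] turns a sum of terms u X^n v into X^n times the sum of the products u v. *)
Lemma gen_ideal_polyXn (R : nzRingType) n (p : {poly R}) :
  p \in gen_ideal 'X^n <-> exists q, p = 'X^n * q.
Proof.
split=> [/gen_idealP[s ->]|[q ->]].
  exists (\sum_(u <- s) u.1 * u.2); rewrite mulr_sumr.
  by apply: eq_bigr => u _; rewrite commr_polyXn -mulrA.
by apply/gen_idealP; exists [:: (1, q)]; rewrite big_seq1 mul1r.
Qed.

Lemma polyXn_mulI (R : nzRingType) n (p q : {poly R}) :
  'X^n * p = 'X^n * q -> p = q.
Proof. by rewrite -!commr_polyXn => /(monic_rreg (monicXn _ _)). Qed.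

Lemma truncation_quot (R : nzRingType) n : (0 < n)%N ->
  truncation n (fun r : R => quot_pi 'X^n r%:P) (quot_pi 'X^n 'X).
Proof.
move=> n_gt0.
have pi0 (p : {poly R}) :
    quot_pi 'X^n p = 0 <-> exists q, p = 'X^n * q.
  rewrite -(rmorph0 (quot_pi ('X^n : {poly R}))).
  by rewrite quot_pi_eq subr0 gen_ideal_polyXn.
split.
- by move=> a b; rewrite polyCB rmorphB.
- by move=> a b; rewrite polyCM rmorphM.
- move=> t; have [p <-] := quot_pi_surj t.
  by rewrite /GRing.comm -!rmorphM /= -['X]expr1 commr_polyXn.
- by rewrite -rmorphXn; apply/pi0; exists 1; rewrite mulr1.
- move=> t; have [p <-] := quot_pi_surj t.
  (* Induction serves only to split off the constant coefficient [c]. *)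
  elim/poly_ind: p => [|p c _].
    by exists 0, 0; rewrite rmorph0 mulr0 addr0.
  exists c, (quot_pi 'X^n p); rewrite -rmorphM -rmorphD.
  by rewrite addrC -['X]expr1 commr_polyXn.
- move=> k t kn; have [p <-] := quot_pi_surj t.
  rewrite -rmorphXn -rmorphM => /pi0[q].
  rewrite -{1}(subnKC kn) exprD -mulrA => /polyXn_mulI ->.
  by exists (quot_pi 'X^n q); rewrite -rmorphXn -rmorphM.
- move=> r; rewrite -rmorphXn -rmorphM => /pi0[q].
  rewrite -{2}(prednK n_gt0) exprSr -mulrA => /polyXn_mulI /polyP /(_ 0%N).
  by rewrite coefC coefXM.
Qed.

Lemma truncation_trunc_poly (R : pzRingType) n : (0 < n)%N ->
  exists i x, @truncation R (trunc_poly R n) n i x.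
Proof.
move=> n_gt0; rewrite /trunc_poly; case: pselect => [R10|R1].
  have all0 (r : R) : r = 0 by rewrite -[r]mulr1 R10 mulr0.
  exists id, 0; split=> //.
  - by move=> t; apply/commr_sym/commr0.
  - by move=> t; exists 0, 0; rewrite (all0 t) mulr0 addr0.
  - by move=> k t _ _; exists 0; rewrite mulr0.
(* The fields are transferred one by one, since the parameter changes from [nz_ring R1] to [R]. *)
have [] := truncation_quot (nz_ring R1) n_gt0.
by exists (fun r => quot_pi 'X^n (polyC (r : nz_ring R1))), (quot_pi 'X^n 'X).
Qed.

(** * Unit regularity and the final equivalences *)

Lemma reduced_unit_regularE (R : pzRingType) : reduced_ring R ->
  unit_regular_ring R <-> regular_ring R.
Proof.
move=> R_reduced; split=> [ureg a|reg a].
  by have [u [_ ?]] := ureg a; exists u.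
have [s [asa sa asC]] := reduced_regular_inverse R_reduced reg a.
have [v [uv vu]] := is_unit_add_compl asa sa asC.
exists v; split; first by exists (a + (1 - a * s)).
(* Since [v] inverts [a + (1 - a * s)], this identity gives [a * v = a * s], hence
   [a * v * a = a]. *)
have au : a * s * (a + (1 - a * s)) = a.
  by rewrite mulrDr asa mulrBr mulr1 mulrA asa subrr addr0.
by rewrite -{2}au -(mulrA _ _ v) uv mulr1 asa.
Qed.

Lemma left_morphic_quasi (S : pzRingType) :
  left_morphic S -> left_quasi_morphic S.
Proof. by move=> lm a; have [b [? ?]] := lm a; exists b, b. Qed.

Lemma left_quasi_morphic_pseudo (S : pzRingType) :
  left_quasi_morphic S -> left_pseudo_morphic S.
Proof. by move=> lq a; have [b [c [? _]]] := lq a; exists b. Qed.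

Lemma right_morphic_quasi (S : pzRingType) :
  right_morphic S -> right_quasi_morphic S.
Proof. by move=> rm a; have [b [? ?]] := rm a; exists b, b. Qed.

Lemma right_quasi_morphic_pseudo (S : pzRingType) :
  right_quasi_morphic S -> right_pseudo_morphic S.
Proof. by move=> rq a; have [b [c [? _]]] := rq a; exists b. Qed.

Lemma morphic_quasi (S : pzRingType) : morphic S -> quasi_morphic S.
Proof.
by move=> [lm rm]; split;
  [apply: left_morphic_quasi | apply: right_morphic_quasi].
Qed.

Lemma quasi_morphic_pseudo (S : pzRingType) :
  quasi_morphic S -> pseudo_morphic S.
Proof.
move=> [lq rq]; split; first exact: left_quasi_morphic_pseudo.
exact: right_quasi_morphic_pseudo.
Qed.

Theorem theorem13 (R : pzRingType) (n : nat) (R_reduced : reduced_ring R)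
    (n_gt0 : (0 < n)%N) :
  [<-> left_pseudo_morphic R;
       left_quasi_morphic R;
       left_morphic R;
       left_pseudo_morphic (trunc_poly R n);
       left_quasi_morphic (trunc_poly R n);
       left_morphic (trunc_poly R n);
       regular_ring R;
       unit_regular_ring R;
       strongly_regular_ring R]
  /\
  [<-> left_pseudo_morphic R;
       right_pseudo_morphic R;
       right_quasi_morphic R;
       right_morphic R;
       right_pseudo_morphic (trunc_poly R n);
       right_quasi_morphic (trunc_poly R n);
       right_morphic (trunc_poly R n);
       pseudo_morphic R;
       quasi_morphic R;
       morphic R;
       pseudo_morphic (trunc_poly R n);
       quasi_morphic (trunc_poly R n);
       morphic (trunc_poly R n)].
Proof.
have [i [x RT]] := truncation_trunc_poly R n_gt0.
have RR := truncation_self R.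
have lR := trunc_left_pseudo_morphic_regular (ltn0Sn 0) R_reduced RR.
have rR := trunc_right_pseudo_morphic_regular (ltn0Sn 0) R_reduced RR.
have mR := trunc_morphic R_reduced RR.
have lT := trunc_left_pseudo_morphic_regular n_gt0 R_reduced RT.
have rT := trunc_right_pseudo_morphic_regular n_gt0 R_reduced RT.
have mT := trunc_morphic R_reduced RT.
have ureg := reduced_unit_regularE R_reduced.
have sreg := reduced_strongly_regularE R_reduced.
have mq := morphic_quasi; have qp := quasi_morphic_pseudo.
have lmq := left_morphic_quasi; have lqp := left_quasi_morphic_pseudo.
have rmq := right_morphic_quasi; have rqp := right_quasi_morphic_pseudo.
(* A morphic-type premise is weakened to a one-sided pseudo-morphic one, which makes [R] regular;
   regularity makes both rings [morphic], and a morphic-type conclusion is weakened from that. *)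
split; tfae.
- by move=> /lR/mR[/lmq].
- by move=> /lqp/lR/mR[].
- by move=> /lmq/lqp/lR/mT/mq/qp[].
- by move=> /lT/mT[/lmq].
- by move=> /lqp/lT/mT[].
- by move=> /lmq/lqp/lT.
- by move=> /ureg.
- by move=> /ureg/sreg.
- by move=> /sreg/mR/mq/qp[].
- by move=> /lR/mR/mq/qp[].
- by move=> /rR/mR[_ /rmq].
- by move=> /rqp/rR/mR[].
- by move=> /rmq/rqp/rR/mT/mq/qp[].
- by move=> /rT/mT[_ /rmq].
- by move=> /rqp/rT/mT[].
- by move=> /rmq/rqp/rT/mR/mq/qp.
- by move=> [/lR/mR/mq].
- by move=> /qp[/lR/mR].
- by move=> /mq/qp[/lR/mT/mq/qp].
- by move=> [/lT/mT/mq].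
- by move=> /qp[/lT/mT].
- by move=> /mq/qp[/lT/mR/mq/qp[]].
Qed.
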